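(* For every finite regular matroid $\mathcal M$ (with a fixed totally unimodular representing matrix $M$), the face poset $\mathcal{FP}(\mathcal M)$ of the Voronoi cell $V_0$ of the lattice of integer flows $\Lambda(\mathcal M)$ is isomorphic, as a graded poset, to the poset $\mathcal{SC}(\mathcal M)$ of strongly connected orientations of submatroids of $\mathcal M$. More precisely, there is an order-preserving bijection $\phi:\mathcal{FP}(\mathcal M)\to\mathcal{SC}(\mathcal M)$ such that every face $F$ satisfies $\operatorname{codim}(F)=\operatorname{genus}(\phi(F))$, equivalently $\dim F=\operatorname{genus}(\mathcal M)-\operatorname{genus}(\phi(F))$.
   Context: Let $\mathcal M$ be a regular matroid on a finite ground set $E$, represented over $\mathbb R$ by a totally unimodular (TU) matrix $M$ (every square submatrix has determinant in $\{-1,0,1\}$) whose columns $c_e$ are indexed by $e\in E$. Identify $\mathbb R^E$ with standard basis $\{e\}_{e\in E}$, Euclidean inner product $\langle\cdot,\cdot\rangle$ and norm $\|\cdot\|$. Let $\mathcal F=\mathcal F(\mathcal M)=\ker M\subseteq\mathbb R^E$ (real flows) and $\Lambda=\Lambda(\mathcal M)=\ker M\cap\mathbb Z^E$ (integer flows). For $x\in\mathbb R^E$ write $x_e=\langle x,e\rangle$ and $\operatorname{supp}(x)=\{e: x_e\neq 0\}$. $\operatorname{genus}(\mathcal M)=\dim\mathcal F$. The Voronoi cell of $\lambda\in\Lambda$ is $V_\lambda=\{x\in\mathcal F:\|x-\lambda\|\le\|x-\mu\|\ \forall\mu\in\Lambda\}$. $\mathcal{FP}(\mathcal M)$ is the set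 of nonempty faces of the polytope $V_0$ ordered by inclusion, graded by dimension; codimension is taken in $\mathcal F$. An oriented submatroid is a pair $(S,\varepsilon)$ with $S\subseteq E$ and $\varepsilon:S\to\{\pm1\}$. It is strongly connected if for every $e\in S$ there is $w\in\mathbb Z_{\ge0}^S$ with $w_e\ge1$ and $\sum_{f\in S}w_f\varepsilon_f c_f=0$ (i.e. every element lies in a positive integer flow of the reoriented submatrix). The genus of $(S,\varepsilon)$ is the dimension of the kernel of the submatrix $M_S$ of $M$ formed by the columns indexed by $S$. $\mathcal{SC}(\mathcal M)$ is the set of strongly connected oriented submatroids (including $(\emptyset,\emptyset)$), ordered by $(S,\varepsilon)\le(S',\varepsilon')$ iff $S'\subseteq S$ and $\varepsilon'=\varepsilon|_{S'}$. *)

(* Defs.v *)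
From HB Require Import structures.
From mathcomp Require Import all_boot all_order all_algebra.
From mathcomp Require Import reals.
Set Implicit Arguments. Unset Strict Implicit. Unset Printing Implicit Defensive.
Import Order.TTheory GRing.Theory Num.Theory.
Local Open Scope ring_scope.

(* Conventions: the ground set E is identified with 'I_n; vectors of R^E are
   row vectors 'rV[R]_n; the representing matrix M : 'M[R]_(m, n) has the
   column c_e = col e M for e : 'I_n. *)

Section Defs.
Variables (R : realType) (m n : nat).
Implicit Types (M : 'M[R]_(m, n)) (x y : 'rV[R]_n).

Definition totally_unimodular M : Prop :=
  forall (k : nat) (f : 'I_k -> 'I_m) (g : 'I_k -> 'I_n),
    injective f -> injective g ->
    let d := \det (mxsub f g M) in d = -1 \/ d = 0 \/ d = 1.

Definition is_flow M x : Prop := M *m x^T = 0.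

Definition is_int_flow M x : Prop :=
  is_flow M x /\ forall i : 'I_n, exists z : int, x 0 i = z%:~R.

Definition euclid_norm x : R := Num.sqrt (\sum_(i < n) x 0 i ^+ 2).

Definition voronoi0 M (x : 'rV[R]_n) : Prop :=
  is_flow M x /\
  forall mu, is_int_flow M mu -> euclid_norm x <= euclid_norm (x - mu).

Definition dotp x y : R := \sum_(i < n) x 0 i * y 0 i.

(* Nonempty faces of a convex set C (C itself included via a = 0, b = 0):
   intersections of C with a supporting hyperplane. *)
Definition is_face (C F : 'rV[R]_n -> Prop) : Prop :=
  (exists x, F x) /\
  exists (a : 'rV[R]_n) (b : R),
    (forall x, C x -> dotp a x <= b) /\
    (forall x, F x <-> (C x /\ dotp a x = b)).

Definition aff_indep_in (S : 'rV[R]_n -> Prop) (d : nat) : Prop :=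
  exists (p0 : 'rV[R]_n) (P : 'M[R]_(d, n)),
    S p0 /\ (forall i, S (p0 + row i P)) /\ row_free P.
Definition has_affdim (S : 'rV[R]_n -> Prop) (d : nat) : Prop :=
  aff_indep_in S d /\ forall d', aff_indep_in S d' -> (d' <= d)%N.

Definition genus M : nat := \rank (kermx M^T).

(* Oriented submatroids (S, eps): encoded as sigma : {ffun 'I_n -> option bool}
   with S = {e | sigma e <> None} and eps e = +1 if sigma e = Some true,
   eps e = -1 if sigma e = Some false.  This is a bijective encoding. *)
Definition osub := {ffun 'I_n -> option bool}.
Definition os_supp (s : osub) : {set 'I_n} := [set e | s e != None].
Definition os_sign (s : osub) (e : 'I_n) : R :=
  match s e with Some true => 1 | Some false => -1 | None => 0 end.

Definition strongly_connected M (s : osub) : Prop :=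
  forall e, e \in os_supp s ->
    exists w : 'I_n -> nat, (1 <= w e)%N /\
      \sum_(f in os_supp s) ((w f)%:R * os_sign s f) *: col f M = 0.

Definition colsub_set M (S : {set 'I_n}) : 'M[R]_(m, #|S|) :=
  colsub (fun i : 'I_#|S| => enum_val i) M.

Definition os_genus M (s : osub) : nat :=
  \rank (kermx (colsub_set M (os_supp s))^T).

Definition os_le (s s' : osub) : Prop :=
  os_supp s' \subset os_supp s /\
  forall e, e \in os_supp s' -> s' e = s e.

End Defs.

(* Main.v *)
Require Import Defs.
From HB Require Import structures.
From mathcomp Require Import all_boot all_order all_algebra.
From mathcomp Require Import reals boolp.
From mathcomp Require Import ring lra.
Set Implicit Arguments. Unset Strict Implicit. Unset Printing Implicit Defensive.
Import Order.TTheory GRing.Theory Num.Theory.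
Local Open Scope ring_scope.

(** Minimally supported flows of a totally unimodular matrix are multiples of
    their sign vectors by Cramer's rule, so every flow is a nonnegative
    combination of {-1, 0, 1}-valued flows conformal to it. Hence the Voronoi
    cell is cut out of the space of flows by [2 <a, x> <= |a|_1] for all real
    flows [a], and the sign vectors of real flows are exactly the strongly
    connected oriented submatroids. The orthogonal projection of the cube
    [[-1/2, 1/2]^E] lies in the cell and attains every one of these bounds, so
    the nonempty faces are [F_a = {x | 2 <a, x> = |a|_1}]. Since
    [<b, sgn a> = |b|_1] exactly when [b] is conformal to [a], evaluating at the
    projection of [sgn a / 2] shows that [F_a] lies in [F_b] only if [b] is
    conformal to [a]. The directions of [F_a] are the projections of the
    coordinate vectors outside [supp a], whose orthogonal complement among the
    flows consists of the flows supported in [supp a]. *)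

Section Correspondence.
Context {A T U : Type} (D : A -> Prop) (P : T -> Prop) (Q : U -> Prop).
Variables (f : A -> T) (g : A -> U).
Hypothesis imageP : forall t, P t <-> exists2 a, D a & f a = t.
Hypothesis imageQ : forall u, Q u <-> exists2 a, D a & g a = u.
Hypothesis same_fibers : forall a b, D a -> D b -> f a = f b <-> g a = g b.

Lemma bijective_images : exists2 phi : {t | P t} -> {u | Q u}, bijective phi &
  forall t, exists a, [/\ D a, sval t = f a & sval (phi t) = g a].
Proof.
have sval_inj V (W : V -> Prop) : injective (@sval V W).
  by move=> [u Wu] [v Wv] /= uv; exact: eq_exist.
pose pre_f (t : {t | P t}) := cid2 ((imageP _).1 (svalP t)).
pose pre_g (u : {u | Q u}) := cid2 ((imageQ _).1 (svalP u)).
pose phi t : {u | Q u} :=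
  exist _ _ ((imageQ _).2 (ex_intro2 _ _ _ (s2valP (pre_f t)) erefl)).
pose psi u : {t | P t} :=
  exist _ _ ((imageP _).2 (ex_intro2 _ _ _ (s2valP (pre_g u)) erefl)).
exists phi => [|t]; last first.
  by exists (s2val (pre_f t)); rewrite (s2valP' (pre_f t)); split=> //; exact: s2valP.
exists psi => [t|u]; apply: sval_inj => /=.
  rewrite -[RHS](s2valP' (pre_f t)); apply/same_fibers; try exact: s2valP.
  exact: (s2valP' (pre_g (phi t))).
rewrite -[RHS](s2valP' (pre_g u)); apply/same_fibers; try exact: s2valP.
exact: (s2valP' (pre_f (psi u))).
Qed.

End Correspondence.

Lemma injective_fwith (I J : eqType) (g : I -> J) i0 j0 :
  injective g -> (forall i, g i != j0) -> injective [eta g with i0 |-> j0].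
Proof.
move=> g_inj g_ne i i' /=; case: eqP => [->|_]; case: eqP => [->|_] // /eqP.
- by rewrite eq_sym (negPf (g_ne i')).
- by rewrite (negPf (g_ne i)).
- by move/eqP; exact: g_inj.
Qed.

Section Support.
Context {V : nmodType} {n : nat}.
Implicit Types x : 'rV[V]_n.

Definition vsupp x : {set 'I_n} := [set e | x 0 e != 0].

Lemma vsupp_eq0 x : (vsupp x == set0) = (x == 0).
Proof.
apply/eqP/eqP => [/setP x0|->]; last by apply/setP => i; rewrite !inE mxE eqxx.
by apply/rowP => i; have := x0 i; rewrite !inE mxE => /negbFE/eqP.
Qed.

End Support.

Section CoordinateSubspaces.
Context {F : fieldType} {n : nat}.
Implicit Types (x : 'rV[F]_n) (S : {set 'I_n}).

Definition coord_mx S : 'M[F]_(#|S|, n) := rowsub enum_val 1%:M.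

Lemma row_coord_mx S i : row i (coord_mx S) = delta_mx 0 (enum_val i).
Proof. by rewrite row_rowsub row1. Qed.

Lemma mulmx_coord_mx_tr m (A : 'M[F]_(m, n)) S :
  A *m (coord_mx S)^T = colsub enum_val A.
Proof. by rewrite trmx_mxsub trmx1 mulmx_colsub mulmx1. Qed.

Lemma coord_mx_free S : row_free (coord_mx S).
Proof.
apply/row_freeP; exists (coord_mx S)^T; rewrite mulmx_coord_mx_tr.
by apply/matrixP => i j; rewrite !mxE (inj_eq enum_val_inj).
Qed.

Lemma rank_coord_mx S : \rank (coord_mx S) = #|S|.
Proof. exact/eqP/coord_mx_free. Qed.

Lemma kermx_coord_mxC S : (kermx (coord_mx (~: S))^T :=: coord_mx S)%MS.
Proof.
apply/eqmx_sym/eqmxP; have coord_ker : (coord_mx S <= kermx (coord_mx (~: S))^T)%MS.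
  apply/sub_kermxP; rewrite mulmx_coord_mx_tr; apply/matrixP => i j; rewrite !mxE.
  case: eqP => // ij; have := enum_valP j.
  by rewrite inE -ij enum_valP.
rewrite -(mxrank_leqif_eq coord_ker) mxrank_ker mxrank_tr !rank_coord_mx.
by rewrite [X in X == _]cardsCs card_ord.
Qed.

Lemma sub_coord_mx x S : (x <= coord_mx S)%MS = (vsupp x \subset S).
Proof.
rewrite -kermx_coord_mxC; apply/sub_kermxP/subsetP; rewrite mulmx_coord_mx_tr.
  move=> x0 e; apply: contraTT => eS; rewrite inE negbK.
  have eC : e \in ~: S by rewrite inE.
  by have /rowP/(_ (enum_rank_in eC e)) := x0; rewrite !mxE enum_rankK_in // => ->.
move=> sxS; apply/rowP => i; rewrite !mxE; apply/eqP/negPn/negP => xi.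
by have := enum_valP i; rewrite inE sxS // inE.
Qed.

End CoordinateSubspaces.

Section OrthogonalProjection.
Context {F : realFieldType} {n : nat}.

Lemma mulmx_tr_eq0 p (A : 'M[F]_(p, n)) : (A *m A^T == 0) = (A == 0).
Proof.
apply/eqP/eqP => [AA0|->]; last by rewrite mul0mx.
apply/matrixP => i j; rewrite mxE; apply/eqP.
have /psumr_eq0P : forall k, true -> 0 <= A i k ^+ 2 by move=> k _; exact: sqr_ge0.
have /matrixP/(_ i i) := AA0; rewrite !mxE => sum0 /(_ _ j isT)/eqP.
rewrite sqrf_eq0; apply.
by rewrite -[RHS]sum0; apply: eq_bigr => k _; rewrite mxE expr2.
Qed.

Lemma gram_unitmx p (B : 'M[F]_(p, n)) : row_free B -> B *m B^T \in unitmx.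
Proof.
move=> Bfree; rewrite -row_free_unit -kermx_eq0; apply/rowV0P => v /sub_kermxP vB.
apply/eqP; rewrite -(mulmx_free_eq0 _ Bfree) -mulmx_tr_eq0 trmx_mul mulmxA.
by rewrite -(mulmxA v) vB mul0mx.
Qed.

Context {p : nat} (A : 'M[F]_(p, n)).

Definition ortho_proj : 'M[F]_n :=
  let B := row_base A in B^T *m invmx (B *m B^T) *m B.

Lemma tr_ortho_proj : ortho_proj^T = ortho_proj.
Proof.
rewrite /ortho_proj; move: (row_base A) => B /=.
by rewrite !trmx_mul trmx_inv trmx_mul !trmxK mulmxA.
Qed.

Lemma ortho_proj_sub q (U : 'M[F]_(q, n)) : (U *m ortho_proj <= A)%MS.
Proof. by rewrite mulmxA (submx_trans (submxMl _ _)) // eq_row_base. Qed.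

Lemma ortho_proj_id q (U : 'M[F]_(q, n)) : (U <= A)%MS -> U *m ortho_proj = U.
Proof.
rewrite -(eq_row_base A) => /submxP[C ->]; rewrite /ortho_proj.
have := row_base_free A; move: (row_base A) C => B C Bfree /=.
by rewrite !mulmxA -(mulmxA C) mulmxK // gram_unitmx.
Qed.

Lemma eqmx_ortho_proj : (ortho_proj :=: A)%MS.
Proof.
apply/eqmxP/andP; split; first by rewrite -[ortho_proj]mul1mx ortho_proj_sub.
by rewrite -[X in (X <= _)%MS](ortho_proj_id (submx_refl A)) submxMl.
Qed.

Lemma mulmx_tr_ortho_proj q r (U : 'M[F]_(q, n)) (V : 'M[F]_(r, n)) :
  (U <= A)%MS -> U *m (V *m ortho_proj)^T = U *m V^T.
Proof. by move=> UA; rewrite trmx_mul tr_ortho_proj mulmxA ortho_proj_id. Qed.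

Lemma rank_mul_ortho_proj q (V : 'M[F]_(q, n)) :
  (\rank (V *m ortho_proj) + \rank (A :&: kermx V^T))%N = \rank A.
Proof.
rewrite -mxrank_tr trmx_mul tr_ortho_proj (eqmxMr _ eqmx_ortho_proj).
exact: mxrank_mul_ker.
Qed.

(* Inside [A], the orthogonal complement of the projection of [V] is
   [A :&: kermx V^T]; the inclusion below is biduality. *)
Lemma sub_mul_ortho_proj q r (U : 'M[F]_(q, n)) (V : 'M[F]_(r, n)) :
  (U <= A)%MS -> U *m (A :&: kermx V^T)%MS^T = 0 -> (U <= V *m ortho_proj)%MS.
Proof.
move=> UA U_ortho; rewrite submxE; set C := cokermx _.
have : (C^T *m ortho_proj <= A :&: kermx V^T)%MS.
  rewrite sub_capmx ortho_proj_sub; apply/sub_kermxP.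
  by rewrite -tr_ortho_proj -!trmx_mul mulmxA mulmx_coker trmx0.
case/submxP => W WE; have := mulmx_tr_ortho_proj C^T UA.
by rewrite WE trmx_mul trmxK mulmxA U_ortho mul0mx => <-.
Qed.

End OrthogonalProjection.

Section SignVectors.
Context {F : realFieldType} {n : nat}.
Implicit Types a b x : 'rV[F]_n.

Definition l1norm x : F := \sum_e `|x 0 e|.

Definition sgrow x : 'rV[F]_n := map_mx Num.sg x.

Definition conformal b a : bool :=
  [forall e, (b 0 e == 0) || (Num.sg (b 0 e) == Num.sg (a 0 e))].

Lemma conformalP b a :
  reflect (forall e, b 0 e != 0 -> Num.sg (b 0 e) = Num.sg (a 0 e)) (conformal b a).
Proof.
apply: (iffP forallP) => ba e; first by have := ba e; case: eqP => //= _ /eqP.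
by case: eqP => //= /eqP/ba ->.
Qed.

Lemma mulr_le_norml (u v : F) : `|v| <= 1 -> u * v <= `|u|.
Proof. by move=> v1; rewrite (le_trans (ler_norm _)) // normrM ler_piMr. Qed.

Lemma norm_sgrow_le1 x e : `|sgrow x 0 e| <= 1.
Proof. by rewrite mxE normr_sg lern1 leq_b1. Qed.

Lemma l1norm0 : l1norm 0 = 0.
Proof. by rewrite /l1norm big1 // => e _; rewrite mxE normr0. Qed.

Lemma conformal_sgrow x : conformal (sgrow x) x.
Proof. by apply/conformalP => e _; rewrite mxE sgr_id. Qed.

Lemma conformal_refl : reflexive conformal.
Proof. by move=> x; apply/conformalP. Qed.

Lemma conformal_neq0 b a e : conformal b a -> b 0 e != 0 -> a 0 e != 0.
Proof. by move=> /conformalP ba be; rewrite -sgr_eq0 -ba // sgr_eq0. Qed.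

Lemma conformal_vsupp b a : conformal b a -> vsupp b \subset vsupp a.
Proof. by move=> ba; apply/subsetP => e; rewrite !inE; exact: conformal_neq0. Qed.

Lemma conformal_trans : transitive conformal.
Proof.
move=> b a c ab bc; apply/conformalP => e ae.
by rewrite (conformalP _ _ ab) // (conformalP _ _ bc) // (conformal_neq0 ab).
Qed.

Lemma mulr_sg_conformal b a e : conformal b a -> b 0 e * Num.sg (a 0 e) = `|b 0 e|.
Proof.
move=> /conformalP ba; have [->|be] := eqVneq (b 0 e) 0.
  by rewrite mul0r normr0.
by rewrite -ba // mulrC -normrEsg.
Qed.

Lemma conformal_ratio_gt0 b a e : conformal b a -> b 0 e != 0 -> 0 < a 0 e / b 0 e.
Proof.
move=> /conformalP ba be.
by rewrite -sgr_gt0 sgrM sgrV -ba // -expr2 sqr_sg be.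
Qed.

Lemma conformal_sub a b : (forall e, `|b 0 e| <= `|a 0 e|) -> conformal (a - b) a.
Proof.
move=> le_ba; apply/conformalP => e; rewrite !mxE => abe; have := le_ba e.
case: (ltrgtP (a 0 e) 0) => ae.
- rewrite (ltr0_norm ae) (ltr0_sg ae) ler_norml => /andP[be _].
  by apply: ltr0_sg; rewrite lt_neqAle abe /=; lra.
- rewrite (gtr0_norm ae) (gtr0_sg ae) ler_norml => /andP[_ be].
  by apply: gtr0_sg; rewrite lt_neqAle eq_sym abe /=; lra.
- by move: abe; rewrite ae normr0 normr_le0 sub0r oppr_eq0 => /negPf ->.
Qed.

(* Take [e] minimising [`|a 0 e / b 0 e|]: then no coordinate changes sign. *)
Lemma exhausting_multiple a b : b != 0 -> vsupp b \subset vsupp a ->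
  exists2 e, b 0 e != 0 & let c := a - (a 0 e / b 0 e) *: b in
    conformal c a /\ vsupp c \proper vsupp a.
Proof.
rewrite -vsupp_eq0 => /set0Pn[e0]; rewrite inE => be0 /subsetP sba.
have [e be min_e] :=
  arg_minP (P := fun e => b 0 e != 0) (fun e => `|a 0 e / b 0 e|) be0.
exists e => //; set c := _ - _; have ca : conformal c a.
  apply: conformal_sub => f; rewrite mxE normrM.
  have [->|bf] := eqVneq (b 0 f) 0; first by rewrite normr0 mulr0.
  by rewrite -ler_pdivlMr ?normr_gt0 // -normf_div min_e.
split=> //; apply/properP; split; first exact: conformal_vsupp.
exists e; first by rewrite sba // inE.
by rewrite inE !mxE divfK // subrr eqxx.
Qed.

Lemma sgrow_conformal_sum (I : finType) (x : I -> 'rV[F]_n) a :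
  (forall i, conformal (x i) a) ->
  (forall e, a 0 e != 0 -> exists i, x i 0 e != 0) ->
  sgrow (\sum_i x i) = sgrow a.
Proof.
move=> xa cover; apply/rowP => e; rewrite !mxE summxE.
have sumE : (\sum_i x i 0 e) * Num.sg (a 0 e) = \sum_i `|x i 0 e|.
  by rewrite mulr_suml; apply: eq_bigr => i _; exact: mulr_sg_conformal.
have [ae|ae] := eqVneq (a 0 e) 0.
  have := esym sumE; rewrite ae sgr0 mulr0 => /psumr_eq0P x0.
  by rewrite big1 ?sgr0 // => i _; apply/normr0_eq0/x0.
have [i xi] := cover e ae.
have : Num.sg ((\sum_i x i 0 e) * Num.sg (a 0 e)) = 1.
  rewrite sumE gtr0_sg // (bigD1 i) //= ltr_pwDl ?normr_gt0 //.
  exact: sumr_ge0.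
rewrite sgrM sgr_id => /(congr1 ( *%R^~ (Num.sg (a 0 e)))).
by rewrite -mulrA -expr2 sqr_sg ae mulr1 mul1r.
Qed.

End SignVectors.

Section EuclideanSpace.
Context {R : realType} {n : nat}.
Implicit Types (a b x y : 'rV[R]_n).

Lemma dotpE x y : dotp x y = (x *m y^T) 0 0.
Proof. by rewrite mxE; apply: eq_bigr => i _; rewrite mxE. Qed.

Lemma dotpC x y : dotp x y = dotp y x.
Proof. by apply: eq_bigr => i _; rewrite mulrC. Qed.

Fact dotp_is_bilinear : bilinear_for
  (GRing.Scale.Law.clone _ _ *%R _) (GRing.Scale.Law.clone _ _ *%R _) (@dotp R n).
Proof.
split=> z t x y /=; rewrite !dotpE; first by rewrite mulmxDl -scalemxAl !mxE.
by rewrite linearP /= mulmxDr -scalemxAr !mxE.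
Qed.

HB.instance Definition _ := bilinear_isBilinear.Build R 'rV[R]_n 'rV[R]_n R
  (GRing.Scale.Law.clone _ _ *%R _) (GRing.Scale.Law.clone _ _ *%R _) (@dotp R n)
  dotp_is_bilinear.

Lemma leif_dotp_sgrow a b : dotp b (sgrow a) <= l1norm b ?= iff conformal b a.
Proof.
apply: leif_sum => e _; split; first exact/mulr_le_norml/norm_sgrow_le1.
rewrite mxE; have [->|be] /= := eqVneq (b 0 e) 0; first by rewrite mul0r normr0 eqxx.
by rewrite normrEsg [X in _ == X]mulrC (inj_eq (mulfI be)) eq_sym.
Qed.

Lemma dotp_sgrow_conformal b a : conformal b a -> dotp b (sgrow a) = l1norm b.
Proof. by rewrite -(leif_dotp_sgrow a b) => /eqP. Qed.

Lemma dotp_sgrow a : dotp a (sgrow a) = l1norm a.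
Proof. exact/dotp_sgrow_conformal/conformal_refl. Qed.

Lemma dotp_le_l1norm a y : (forall e, `|y 0 e| <= 1) -> dotp a y <= l1norm a.
Proof. by move=> y1; apply: ler_sum => e _; exact: mulr_le_norml. Qed.

Lemma l1norm_int_le a :
  (forall e, exists z : int, a 0 e = z%:~R) -> l1norm a <= dotp a a.
Proof.
move=> a_int; apply: ler_sum => e _; have [z ->] := a_int e.
rewrite -expr2 -real_normK ?num_real // -intr_norm expr2 -intrM ler_int.
by have [->|z0] := eqVneq z 0; rewrite ?normr0 // ler_peMr // -gtz0_ge1 normr_gt0.
Qed.

Lemma euclid_norm_le_sub x y :
  (euclid_norm x <= euclid_norm (x - y)) = (2 * dotp y x <= dotp y y).
Proof.
have normE z : euclid_norm z = Num.sqrt (dotp z z).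
  by congr Num.sqrt; apply: eq_bigr => i _; rewrite expr2.
rewrite !normE ler_sqrt; last by apply: sumr_ge0 => i _; rewrite -expr2 sqr_ge0.
rewrite linearBl /= !linearBr /= (dotpC x y).
by apply/idP/idP; lra.
Qed.

Lemma has_affdim_rank (S : 'rV[R]_n -> Prop) p0 k (A : 'M[R]_(k, n)) :
  S p0 -> (forall i, S (p0 + row i A)) ->
  (forall x y, S x -> S y -> (x - y <= A)%MS) -> has_affdim S (\rank A).
Proof.
move=> Sp0 SA subA; split=> [|d [q0 [Q [Sq0 [SQ /eqP <-]]]]].
  exists p0, (rowsub (maxrankfun A) A); split=> //; split=> [i|].
    by rewrite row_rowsub.
  exact: maxrowsub_free.
apply/mxrankS/row_subP => i.
by rewrite -[row i Q](addKr q0) addrC subA.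
Qed.

End EuclideanSpace.

Section OrientedSubmatroids.
Context (R : realType) {n : nat}.
Implicit Types (s : osub n) (a b : 'rV[R]_n).

Definition os_row s : 'rV[R]_n := \row_e os_sign R s e.

Definition sign_vector a : osub n :=
  [ffun e => if a 0 e == 0 then None else Some (0 < a 0 e)].

Lemma vsupp_os_row s : vsupp (os_row s) = os_supp s.
Proof.
apply/setP => e; rewrite !inE mxE /os_sign.
by case: (s e) => [[]|]; rewrite ?oppr_eq0 ?oner_eq0 ?eqxx.
Qed.

Lemma os_supp_sign_vector a : os_supp (sign_vector a) = vsupp a.
Proof. by apply/setP => e; rewrite !inE ffunE; case: (a 0 e == 0). Qed.

Lemma os_sign_sign_vector a e : os_sign R (sign_vector a) e = Num.sg (a 0 e).
Proof. by rewrite /os_sign ffunE; case: sgrP. Qed.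

Lemma os_sign_inj s s' e : os_sign R s e = os_sign R s' e -> s e = s' e.
Proof.
rewrite /os_sign.
by case: (s e) (s' e) => [[]|] [[]|] // => [|||||] eq_sign; exfalso; lra.
Qed.

Lemma sgrow_os_row s : sgrow (os_row s) = os_row s.
Proof.
apply/rowP => e; rewrite !mxE /os_sign.
by case: (s e) => [[]|]; rewrite ?sgrN ?sgr1 ?sgr0.
Qed.

Lemma sign_vector_eq a s : sgrow a = os_row s -> sign_vector a = s.
Proof.
move=> /rowP aE; apply/ffunP => e; apply: os_sign_inj.
by have := aE e; rewrite !mxE os_sign_sign_vector.
Qed.

Lemma os_le_sign_vector a b :
  os_le (sign_vector a) (sign_vector b) <-> conformal b a.
Proof.
rewrite /os_le !os_supp_sign_vector; split=> [[_ eq_ba]|ba].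
  by apply/conformalP => e be; rewrite -!os_sign_sign_vector /os_sign eq_ba // inE.
split=> [|e]; first exact: conformal_vsupp.
rewrite inE => be; apply: os_sign_inj.
by rewrite !os_sign_sign_vector; exact: (conformalP _ _ ba).
Qed.

Lemma os_le_anti s s' : os_le s s' -> os_le s' s -> s = s'.
Proof.
move=> [s's _] [ss' eq_s]; apply/ffunP => e.
have [es|es] := boolP (e \in os_supp s); first exact: eq_s.
have := contra (subsetP s's e) es; move: es.
by rewrite !inE !negbK => /eqP -> /eqP ->.
Qed.

End OrientedSubmatroids.

Section CramerRule.
Context {F : comPzRingType} {k : nat}.

Lemma cramer_rule (B : 'M[F]_k) (v c : 'cV[F]_k) j : B *m v = c ->
  \det B * v j 0 = \det (\matrix_(i, l) if l == j then c i 0 else B i l).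
Proof.
move=> <-; transitivity ((\adj B *m (B *m v)) j 0).
  by rewrite mulmxA mul_adj_mx mul_scalar_mx mxE.
rewrite (expand_det_col _ j) mxE; apply: eq_bigr => i _.
rewrite !mxE eqxx mulrC /cofactor; congr (_ * (_ * \det _)).
by apply/matrixP => r l; rewrite !mxE eq_sym (negPf (neq_lift j l)).
Qed.

End CramerRule.

Section Flows.
Context {R : realType} {m n : nat}.
Variable M : 'M[R]_(m, n).
Implicit Types (a b x y mu : 'rV[R]_n) (S : {set 'I_n}).

Lemma is_flowE x : is_flow M x <-> (x <= kermx M^T)%MS.
Proof.
rewrite /is_flow; split=> [xf|/sub_kermxP xf].
  by apply/sub_kermxP; rewrite -[x]trmxK -trmx_mul xf trmx0.
by rewrite -[M]trmxK -trmx_mul xf trmx0.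
Qed.

Lemma flowZ (t : R) x : is_flow M x -> is_flow M (t *: x).
Proof. by rewrite !is_flowE; exact: scalemx_sub. Qed.

Lemma flowB x y : is_flow M x -> is_flow M y -> is_flow M (x - y).
Proof. by rewrite !is_flowE => xf yf; rewrite addmx_sub // eqmx_opp. Qed.

Lemma flow_sum_supp x S : vsupp x \subset S ->
  is_flow M x <-> \sum_(e in S) x 0 e *: col e M = 0.
Proof.
move=> /subsetP sxS; suff -> : \sum_(e in S) x 0 e *: col e M = M *m x^T by [].
rewrite [LHS]big_mkcond /=; apply/colP => i; rewrite summxE mxE.
apply: eq_bigr => e _; rewrite !mxE mulrC; case: ifPn => [_|eS].
  by rewrite !mxE.
have := contra (sxS e) eS; rewrite inE negbK mxE => /eqP ->.
by rewrite mul0r.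
Qed.

Definition elementary_flow a : Prop :=
  [/\ is_flow M a, a != 0
    & forall b, is_flow M b -> vsupp b \proper vsupp a -> b = 0].

Lemma conformal_elementary_flow a : is_flow M a -> a != 0 ->
  exists2 b, elementary_flow b & conformal b a.
Proof.
have [k] := ubnP #|vsupp a|; elim: k a => // k IHk a lt_ak af a0.
have [[b [bf b0 sba]]|no_smaller] := pselect (exists b,
    [/\ is_flow M b, b != 0 & vsupp b \proper vsupp a]); last first.
  exists a; last exact: conformal_refl.
  by split=> // b bf sba; apply/eqP/negPn/negP => b0; apply: no_smaller; exists b.
have [e _ [ca sca]] := exhausting_multiple b0 (proper_sub sba).
set c := a - _ in ca sca.
have [|||d d_elem dc] := IHk c; last by exists d => //; exact: conformal_trans ca.
- exact: leq_trans (proper_card sca) lt_ak.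
- by apply: flowB => //; exact: flowZ.
have [_ [f]] := properP sba; rewrite !inE negbK => af0 /eqP bf0.
by apply: contra_neq af0 => /rowP/(_ f); rewrite !mxE bf0 mulr0 subr0.
Qed.

Lemma elementary_flow_row_full a e0 : elementary_flow a -> a 0 e0 != 0 ->
  row_full (colsub_set M (vsupp a :\ e0)).
Proof.
move=> [af a0 a_min] ae0; set T := vsupp a :\ e0.
rewrite -[colsub_set M T](mulmx_coord_mx_tr M T) /row_full -mxrank_tr trmx_mul trmxK.
rewrite -/(row_free _) -kermx_eq0; apply/rowV0P => v /sub_kermxP vM.
apply/eqP; rewrite -(mulmx_free_eq0 _ (coord_mx_free T)); apply/eqP/a_min.
  by apply/is_flowE/sub_kermxP; rewrite -mulmxA.
have /sub_proper_trans : vsupp (v *m coord_mx T) \subset T.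
  by rewrite -sub_coord_mx submxMl.
by apply; apply: properD1; rewrite inE.
Qed.

Lemma flow_col_combination a e0 : is_flow M a -> a 0 e0 != 0 ->
  let T := vsupp a :\ e0 in
  colsub_set M T *m (\col_l - (a 0 (enum_val l) / a 0 e0)) = col e0 M.
Proof.
move=> /(flow_sum_supp (subxx _)) + ae0 T.
rewrite (big_setD1 e0) ?inE //= -/T => /eqP; rewrite addr_eq0 => /eqP sumT.
apply: (scalerI ae0); rewrite sumT big_enum_val /= -sumrN; apply/colP => i.
rewrite !mxE summxE mulr_sumr; apply: eq_bigr => l _; rewrite !mxE.
by field.
Qed.

Definition unit_flow mu : Prop := is_flow M mu /\ sgrow mu = mu.

Lemma unit_flow_int mu : unit_flow mu -> is_int_flow M mu.
Proof.
move=> [muf /rowP muE]; split=> // e; exists (sgz (mu 0 e)).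
by rewrite -sgrEz -[LHS]muE mxE.
Qed.

Lemma unit_flow_dotp mu : unit_flow mu -> dotp mu mu = l1norm mu.
Proof. by move=> [_ muE]; rewrite -{2}muE dotp_sgrow. Qed.

Lemma strongly_connected_flow_at s e : strongly_connected M s -> e \in os_supp s ->
  exists x, [/\ is_flow M x, conformal x (os_row R s) & x 0 e != 0].
Proof.
move=> sc es; have [w [we w_sum]] := sc e es.
pose x := \row_f ((w f)%:R * os_sign R s f).
have xs : conformal x (os_row R s).
  apply/conformalP => f; rewrite !mxE mulf_eq0 => /norP[wf _].
  by rewrite sgrM gtr0_sg ?mul1r // lt0r wf ler0n.
exists x; split=> //.
  apply/(flow_sum_supp (S := os_supp s)).
    by rewrite -(vsupp_os_row R) conformal_vsupp.
  by rewrite -[RHS]w_sum; apply: eq_bigr => f _; rewrite mxE.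
move: es; rewrite -(vsupp_os_row R) inE !mxE => se.
by rewrite mulf_neq0 // pnatr_eq0 -lt0n.
Qed.

Lemma strongly_connected_flow s : strongly_connected M s ->
  exists2 a, is_flow M a & sign_vector a = s.
Proof.
move=> sc; have /fin_all_exists[x xP] e : exists x,
    [/\ is_flow M x, conformal x (os_row R s) & e \in os_supp s -> x 0 e != 0].
  have [es|es] := boolP (e \in os_supp s).
    by have [x [xf xs xe]] := strongly_connected_flow_at sc es; exists x.
  exists 0; split=> //; first by rewrite is_flowE sub0mx.
  by apply/conformalP => f; rewrite mxE eqxx.
exists (\sum_e x e).
  by apply/is_flowE/summx_sub => e _; apply/is_flowE; case: (xP e).
apply: sign_vector_eq; rewrite -sgrow_os_row; apply: sgrow_conformal_sum => e.
  by case: (xP e).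
move=> se; exists e; have [_ _] := xP e; apply.
by rewrite -(vsupp_os_row R) inE.
Qed.

End Flows.

Section TotallyUnimodular.
Context {R : realType} {m n : nat}.
Variable M : 'M[R]_(m, n).
Implicit Types (a x mu : 'rV[R]_n).

Hypothesis tuM : totally_unimodular M.

Lemma unimodular_minor_norm k (f : 'I_k -> 'I_m) (g : 'I_k -> 'I_n) :
  injective f -> injective g -> \det (mxsub f g M) != 0 -> `|\det (mxsub f g M)| = 1.
Proof.
move=> f_inj g_inj; have [->|[->|->]] := tuM f_inj g_inj.
- by rewrite normrN normr1.
- by rewrite eqxx.
- by rewrite normr1.
Qed.

(* By Cramer's rule, [- a 0 e / a 0 e0] is a quotient of two minors of [M]. *)
Lemma elementary_flow_norm_eq a e e0 : elementary_flow M a ->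
  a 0 e != 0 -> a 0 e0 != 0 -> `|a 0 e| = `|a 0 e0|.
Proof.
move=> a_elem ae ae0; have [-> //|ne] := eqVneq e e0.
have [af _ _] := a_elem.
have fullT := elementary_flow_row_full a_elem ae0.
set T := vsupp a :\ e0 in fullT.
have eT : e \in T by rewrite !inE ne.
pose f := fullrankfun fullT; pose g : 'I_#|T| -> 'I_n := enum_val.
pose j := enum_rank_in eT e; pose g' := [eta g with j |-> e0].
have f_inj : injective f by exact: fullrankfun_inj.
have g'_inj : injective g'.
  apply: injective_fwith => [|l]; first exact: enum_val_inj.
  by have := enum_valP l; rewrite !inE => /andP[].
have Bv : mxsub f g M *m (\col_l - (a 0 (g l) / a 0 e0)) = rowsub f (col e0 M).
  by rewrite -(flow_col_combination af ae0) -mul_rowsub_mx -mxsub_comp.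
have := cramer_rule j Bv; rewrite mxE /g enum_rankK_in // -/g.
have -> : (\matrix_(i, l)
    if l == j then rowsub f (col e0 M) i 0 else mxsub f g M i l) = mxsub f g' M.
  by apply/matrixP => i l; rewrite !mxE /=; case: eqP.
have detB : \det (mxsub f g M) != 0.
  rewrite -unitfE -unitmxE.
  have -> : mxsub f g M = rowsub f (colsub_set M T) by rewrite -mxsub_comp.
  exact: fullrowsub_unit.
move=> detE; have detB' : \det (mxsub f g' M) != 0.
  by rewrite -detE mulf_neq0 // oppr_eq0 mulf_neq0 ?invr_eq0.
move/(congr1 Num.norm): detE.
rewrite normrM !unimodular_minor_norm ?mul1r //; last exact: enum_val_inj.
by rewrite normrN normf_div => /divr1_eq.
Qed.

Lemma elementary_sgrow_flow a : elementary_flow M a -> is_flow M (sgrow a).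
Proof.
move=> a_elem; have [af a0 _] := a_elem.
have [e0] : exists e0, e0 \in vsupp a by apply/set0Pn; rewrite vsupp_eq0.
rewrite inE => ae0; suff -> : sgrow a = `|a 0 e0|^-1 *: a by exact: flowZ.
apply/rowP => e; rewrite !mxE; have [->|ae] := eqVneq (a 0 e) 0.
  by rewrite sgr0 mulr0.
rewrite [a 0 e in RHS]numEsg (elementary_flow_norm_eq a_elem ae ae0).
by rewrite mulrCA mulVf ?mulr1 ?normr_eq0.
Qed.

Lemma conformal_unit_flow a : is_flow M a -> a != 0 ->
  exists mu, [/\ unit_flow M mu, mu != 0 & conformal mu a].
Proof.
move=> af /(conformal_elementary_flow af)[b b_elem ba]; have [_ b0 _] := b_elem.
have sgb : sgrow (sgrow b) = sgrow b by apply/rowP => e; rewrite !mxE sgr_id.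
exists (sgrow b); split; first by split=> //; exact: elementary_sgrow_flow.
  apply: contra_neq b0 => /rowP sgb0; apply/rowP => e; rewrite !mxE; apply/eqP.
  by have := sgb0 e; rewrite !mxE => /eqP; rewrite sgr_eq0.
exact: conformal_trans (conformal_sgrow b) ba.
Qed.

Lemma conformal_decomposition a : is_flow M a ->
  exists2 s : seq (R * 'rV[R]_n),
    {in s, forall p, [/\ 0 < p.1, unit_flow M p.2 & conformal p.2 a]} &
    a = \sum_(p <- s) p.1 *: p.2.
Proof.
have [k] := ubnP #|vsupp a|; elim: k a => // k IHk a lt_ak af.
have [->|a0] := eqVneq a 0; first by exists [::]; rewrite ?big_nil.
have [mu [mu_unit mu0 mu_a]] := conformal_unit_flow af a0.
have [e mue] := exhausting_multiple mu0 (conformal_vsupp mu_a).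
set t := a 0 e / _ => -[ca sca].
have [||s s_conf cE] := IHk (a - t *: mu).
- exact: leq_trans (proper_card sca) lt_ak.
- by apply: flowB => //; apply: flowZ; case: mu_unit.
exists ((t, mu) :: s); last by rewrite big_cons /= -cE addrC subrK.
move=> p; rewrite inE => /predU1P[->|/s_conf[p0 p_unit pc]].
  by split=> //; exact: conformal_ratio_gt0 mue.
by split=> //; exact: conformal_trans ca.
Qed.

Lemma voronoi0_l1normP x : voronoi0 M x <->
  is_flow M x /\ forall a, is_flow M a -> 2 * dotp a x <= l1norm a.
Proof.
split=> -[xf x_near]; last first.
  split=> // mu [muf mu_int].
  rewrite euclid_norm_le_sub.
  exact: le_trans (x_near _ muf) (l1norm_int_le mu_int).
split=> // a /conformal_decomposition[s s_conf aE].
rewrite -(dotp_sgrow a) {1 2}aE !linear_sumlz mulr_sumr.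
rewrite big_seq [leRHS]big_seq; apply: ler_sum => p /s_conf[p0 p_unit p_a].
rewrite !linearZl_LR /= mulrCA ler_pM2l // (dotp_sgrow_conformal p_a).
by rewrite -(unit_flow_dotp p_unit) -euclid_norm_le_sub; apply/x_near/unit_flow_int.
Qed.

Lemma flow_strongly_connected a :
  is_flow M a -> strongly_connected M (sign_vector a).
Proof.
move=> af e; rewrite os_supp_sign_vector inE => ae.
have [s s_conf aE] := conformal_decomposition af.
have [p /s_conf[_ [muf muE] mu_a] mue] : exists2 p, p \in s & p.2 0 e != 0.
  apply/hasP; apply: contraNT ae => /hasPn s0.
  rewrite aE summxE big_seq big1 // => p ps.
  by rewrite mxE (eqP (negPn (s0 p ps))) mulr0.
exists (fun f => p.2 0 f != 0); split; first by rewrite mue.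
rewrite -[RHS]((flow_sum_supp M (conformal_vsupp mu_a)).1 muf).
apply: eq_bigr => f _; congr (_ *: _); rewrite os_sign_sign_vector.
have [->|muf0] := eqVneq (p.2 0 f) 0; first by rewrite mul0r.
by rewrite mul1r -(conformalP _ _ mu_a) // -[in RHS]muE mxE.
Qed.

Lemma strongly_connectedP s :
  strongly_connected M s <-> exists2 a, is_flow M a & sign_vector a = s.
Proof.
split=> [|[a af <-]]; first exact: strongly_connected_flow.
exact: flow_strongly_connected.
Qed.

End TotallyUnimodular.

Section VoronoiFaces.
Context {R : realType} {m n : nat}.
Variable M : 'M[R]_(m, n).
Implicit Types a b x y : 'rV[R]_n.

Definition flow_face a x : Prop := voronoi0 M x /\ 2 * dotp a x = l1norm a.

Definition zonotope_mx : 'M[R]_n := 2^-1 *: ortho_proj (kermx M^T).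

Definition face_center a : 'rV[R]_n := sgrow a *m zonotope_mx.

Lemma zonotope_flow y : is_flow M (y *m zonotope_mx).
Proof. by rewrite -scalemxAr; apply/flowZ/is_flowE/ortho_proj_sub. Qed.

Lemma dotp_zonotope a y : is_flow M a -> 2 * dotp a (y *m zonotope_mx) = dotp a y.
Proof.
move=> /is_flowE af; rewrite -scalemxAr linearZr_LR /= mulVKf ?pnatr_eq0 //.
by rewrite !dotpE mulmx_tr_ortho_proj.
Qed.

Lemma os_genusE (s : osub n) :
  os_genus M s = \rank (kermx M^T :&: coord_mx (os_supp s)).
Proof.
rewrite /os_genus -[colsub_set _ _](mulmx_coord_mx_tr M) trmx_mul trmxK mxrank_ker.
rewrite capmxC -[X in (X - _)%N](@rank_coord_mx R).
by rewrite -(mxrank_mul_ker (coord_mx _) M^T) addKn.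
Qed.

Hypothesis tuM : totally_unimodular M.

Lemma voronoi0_zonotope y :
  (forall e, `|y 0 e| <= 1) -> voronoi0 M (y *m zonotope_mx).
Proof.
move=> y1; apply/(voronoi0_l1normP tuM); split=> [|a af]; first exact: zonotope_flow.
by rewrite dotp_zonotope // dotp_le_l1norm.
Qed.

Lemma flow_face_center a : is_flow M a -> flow_face a (face_center a).
Proof.
move=> af; split; last by rewrite dotp_zonotope // dotp_sgrow.
exact/voronoi0_zonotope/norm_sgrow_le1.
Qed.

Lemma voronoi0_le x a : voronoi0 M x -> is_flow M a -> 2 * dotp a x <= l1norm a.
Proof. by move=> /(voronoi0_l1normP tuM)[_]; apply. Qed.

Lemma is_face_voronoi0P F :
  is_face (voronoi0 M) F <-> exists2 a, is_flow M a & flow_face a = F.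
Proof.
split=> [[[x0 Fx0] [v [h [supp_h FE]]]]|[a af <-]]; last first.
  split; first by exists (face_center a); exact: flow_face_center.
  exists a, (l1norm a / 2); split=> [x xV|x].
    by have := voronoi0_le xV af; lra.
  by split=> -[xV ax]; split=> //; lra.
pose a := v *m ortho_proj (kermx M^T).
have af : is_flow M a by apply/is_flowE/ortho_proj_sub.
have aE x : voronoi0 M x -> dotp v x = dotp a x.
  by move=> [/is_flowE xf _]; rewrite !(dotpC _ x) !dotpE mulmx_tr_ortho_proj.
have hE : 2 * h = l1norm a.
  apply/eqP; rewrite eq_le; apply/andP; split.
    by have [xV <-] := (FE x0).1 Fx0; rewrite aE // voronoi0_le.
  have [xV <-] := flow_face_center af; rewrite -aE //.
  by rewrite ler_pM2l ?ltr0n // supp_h.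
exists a => //; apply/funext => x; apply/propext; rewrite FE.
by split=> -[xV ax]; split=> //; move: ax; rewrite aE //; lra.
Qed.

Lemma flow_face_sub a b : is_flow M a -> is_flow M b ->
  (forall x, flow_face a x -> flow_face b x) <-> conformal b a.
Proof.
move=> af bf; split=> [sub_ab|ba x [xV ax]].
  have [_] := sub_ab _ (flow_face_center af); rewrite dotp_zonotope // => /eqP.
  by rewrite (leif_dotp_sgrow a b).
split=> //; have [->|b0] := eqVneq b 0; first by rewrite linear0l mulr0 l1norm0.
have [e be] := exhausting_multiple b0 (conformal_vsupp ba).
have t0 := conformal_ratio_gt0 ba be; set t := a 0 e / _ in t0 * => -[ca _].
apply/eqP; rewrite eq_le voronoi0_le //= -(ler_pM2l t0).
have := voronoi0_le xV (flowB af (flowZ t bf)).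
rewrite -(dotp_sgrow_conformal ca) !linearBl /= !linearZl_LR /= dotp_sgrow.
by rewrite (dotp_sgrow_conformal ba); lra.
Qed.

Lemma flow_face_eq a b : is_flow M a -> is_flow M b ->
  flow_face a = flow_face b <-> sign_vector a = sign_vector b.
Proof.
move=> af bf; split=> ab.
  by apply: os_le_anti; apply/os_le_sign_vector/flow_face_sub => //; rewrite ab.
by apply/funext => x; apply/propext; split; move: x;
  apply/flow_face_sub => //; apply/os_le_sign_vector; rewrite ab.
Qed.

Lemma flow_face_dotp_const a b x y : is_flow M a -> is_flow M b ->
  vsupp b \subset vsupp a -> flow_face a x -> flow_face a y -> dotp b x = dotp b y.
Proof.
move=> af bf sba xa ya; have [->|b0] := eqVneq b 0; first by rewrite !linear0l.
have [e be] := exhausting_multiple b0 sba.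
set t := a 0 e / _ => -[ca _].
have t0 : t != 0.
  by rewrite mulf_neq0 ?invr_eq0 //; have /subsetP/(_ e) := sba; rewrite !inE; apply.
have ac := (flow_face_sub af (flowB af (flowZ t bf))).2 ca.
have [_] := ac x xa; have [_] := ac y ya; case: xa ya => _ ax [_ ay].
rewrite !linearBl /= !linearZl_LR /= => cy cx.
by apply: (mulfI t0); lra.
Qed.

Lemma flow_face_add_coord a e : is_flow M a -> e \notin vsupp a ->
  flow_face a (face_center a + delta_mx 0 e *m zonotope_mx).
Proof.
rewrite inE negbK => af /eqP ae; rewrite /face_center -mulmxDl; split.
  apply: voronoi0_zonotope => f; rewrite !mxE /=; have [->|_] := eqVneq f e.
    by rewrite ae sgr0 add0r normr1.
  by rewrite addr0 normr_sg lern1 leq_b1.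
rewrite dotp_zonotope // linearDr /= dotp_sgrow dotpE trmx_delta.
by rewrite -colE mxE ae addr0.
Qed.

Lemma flow_face_sub_direction a x y :
  is_flow M a -> flow_face a x -> flow_face a y ->
  (x - y <= coord_mx (~: vsupp a) *m zonotope_mx)%MS.
Proof.
move=> af xa ya; rewrite -scalemxAr eqmx_scale ?invr_eq0 ?pnatr_eq0 //.
apply: sub_mul_ortho_proj.
  by apply/is_flowE/flowB; [have [[]] := xa|have [[]] := ya].
apply/rowP => i; rewrite mxE [RHS]mxE; set L := (_ :&: _)%MS.
have /andP[Lf] : (row i L <= kermx M^T)%MS &&
    (row i L <= kermx (coord_mx (~: vsupp a))^T)%MS by rewrite -sub_capmx row_sub.
rewrite kermx_coord_mxC sub_coord_mx => Ls.
transitivity (dotp (row i L) (x - y)).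
  by apply: eq_bigr => f _; rewrite !mxE mulrC.
rewrite linearBr /=; apply/eqP; rewrite subr_eq0; apply/eqP.
by apply: flow_face_dotp_const xa ya => //; exact/is_flowE.
Qed.

Lemma flow_face_dim a : is_flow M a -> exists d, has_affdim (flow_face a) d /\
  (d + os_genus M (sign_vector a))%N = genus M.
Proof.
move=> af; exists (\rank (coord_mx (~: vsupp a) *m zonotope_mx)); split.
  apply: (has_affdim_rank (flow_face_center af)) => [i|x y].
    rewrite row_mul row_coord_mx; apply: flow_face_add_coord => //.
    by have := enum_valP i; rewrite inE.
  exact: flow_face_sub_direction.
rewrite -scalemxAr mxrank_scale_nz ?invr_eq0 ?pnatr_eq0 //.
rewrite os_genusE os_supp_sign_vector.
rewrite -(cap_eqmx (eqmx_refl (kermx M^T)) (kermx_coord_mxC (vsupp a))).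
exact: rank_mul_ortho_proj.
Qed.

End VoronoiFaces.

Theorem mainTheorem1 (R : realType) (m n : nat) (M : 'M[R]_(m, n)) :
  totally_unimodular M ->
  exists phi : {F : 'rV[R]_n -> Prop | is_face (voronoi0 M) F} ->
               {s : osub n | strongly_connected M s},
    bijective phi /\
    (forall F G : {F : 'rV[R]_n -> Prop | is_face (voronoi0 M) F},
        ((forall x, sval F x -> sval G x) <-> os_le (sval (phi F)) (sval (phi G)))) /\
    (forall F : {F : 'rV[R]_n -> Prop | is_face (voronoi0 M) F},
        exists d, has_affdim (sval F) d /\ (d + os_genus M (sval (phi F)))%N = genus M).
Proof.
move=> tuM.
have [phi phi_bij phiE] :=
  bijective_images (is_face_voronoi0P tuM) (strongly_connectedP tuM)
    (flow_face_eq tuM).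
exists phi; split=> //; split=> [F G|F].
  have [a [af -> ->]] := phiE F; have [b [bf -> ->]] := phiE G.
  by rewrite os_le_sign_vector; exact: flow_face_sub.
by have [a [af -> ->]] := phiE F; exact: flow_face_dim.
Qed.
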